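(* Let $M$ be a connected topological manifold of dimension at least $2$ with an effective action of a finite group $G$, let $n\ge 2$, and let ${\bf x}=(x_1,\dots,x_n)\in F_G(M,n)$ be a base point such that every orbit $G(x_i)$ is of free type. Let $\alpha,\beta$ be two paths in $F_G(M,n)$ such that $\widetilde{c(\alpha)}$ and $\widetilde{c(\beta)}$ are orbit braids at ${\bf x}$. Then $\widetilde{c(\alpha)}\sim\widetilde{c(\beta)}$ if and only if there are two paths $\alpha'$ and $\beta'$ in $F_G(M,n)$ with $\widetilde{c(\alpha')}=\widetilde{c(\alpha)}$ and $\widetilde{c(\beta')}=\widetilde{c(\beta)}$ such that $\alpha'$ is homotopic to $\beta'$ relative to $\partial I$.
   Context: $F_G(M,n)=\{(y_1,\dots,y_n)\in M^{\times n}\mid G(y_i)\cap G(y_j)=\emptyset \text{ for } i\neq j\}$ with the subspace topology; $G^{\times n}$ acts on it coordinatewise. For an $n$-tuple $y$ and $\sigma\in\Sigma_n$ put $y_\sigma=(y_{\sigma(1)},\dots,y_{\sigma(n)})$. An orbit $G(y)$ is of free type if the isotropy group of $y$ is trivial. $I=[0,1]$ carries the trivial $G$-action. A path $\alpha=(\alpha_1,\dots,\alpha_n):I\to F_G(M,n)$ determines the unordered collection of $n$ strings $c(\alpha)=\{c(\alpha_1),\dots,c(\alpha_n)\}$ in $M\times I$, $c(\alpha_i)=\{(\alpha_i(s),s)\mid s\in I\}$, and the unordered collection of orbit strings $\widetilde{c(\alpha)}=\{\widetilde{c(\alpha_1)},\dots,\widetilde{c(\alpha_n)}\}$, where $\widetilde{c(\alpha_i)}=\{h\,c(\alpha_i)\mid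 h\in G\}$ is a collection of strings. $\widetilde{c(\alpha)}$ is an orbit braid (at ${\bf x}$) if $\alpha(0)={\bf x}$ and $\alpha(1)=g{\bf x}_\sigma$ for some $(g,\sigma)\in G^{\times n}\times\Sigma_n$. For two paths $\alpha,\beta$ in $F_G(M,n)$ with the same endpoints, $c(\alpha)\sim^G_{iso}c(\beta)$ means that there are continuous maps $\widehat F_i:I\times I\to M\times I$, $\widehat F_i(s,t)=(F_i(s,t),s)$, $i=1,\dots,n$, such that (1) $\coprod_i\widehat F_i(s,0)=c(\alpha)$ and $\coprod_i\widehat F_i(s,1)=c(\beta)$; (2) for all $t$, $\coprod_i\widehat F_i(0,t)=c(\alpha)|_{s=0}=c(\beta)|_{s=0}$ and $\coprod_i\widehat F_i(1,t)=c(\alpha)|_{s=1}=c(\beta)|_{s=1}$; (3) $G(F_i(s,t))\cap G(F_j(s,t))=\emptyset$ for all $(s,t)$ and $i\ne j$. Two orbit braids are equivalent, $\widetilde{c(\alpha)}\sim\widetilde{c(\beta)}$, if there are $g,h\in G^{\times n}$ with $c(g\alpha)\sim^G_{iso}c(h\beta)$. *)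

(* Defs.v *)
From HB Require Import structures.
From mathcomp Require Import all_boot all_order all_algebra all_fingroup.
From mathcomp Require Import all_classical all_reals all_analysis.

Set Implicit Arguments.
Unset Strict Implicit.
Unset Printing Implicit Defensive.

Import Order.TTheory GRing.Theory Num.Theory.
Import numFieldNormedType.Exports.

Local Open Scope classical_set_scope.
Local Open Scope ring_scope.

Section Manifold.
Context (R : realType) (m : nat) (M : topologicalType).

Definition locally_euclidean : Prop :=
  forall x : M, exists (U : set M) (phi : M -> 'rV[R]_m) (psi : 'rV[R]_m -> M),
    [/\ open U /\ U x,
        open (phi @` U),
        {within U, continuous phi},
        {within phi @` U, continuous psi}
      & forall y, U y -> psi (phi y) = y].

Definition topological_manifold : Prop :=
  [/\ hausdorff_space M, @second_countable M & locally_euclidean].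

End Manifold.

(* MathComp's [action] is a right action, and its [orbit] and [faithful]
   require a finite carrier, hence the following notions. The group is finite
   and discrete, so an action is jointly continuous iff each translation is
   continuous. *)
Section Action.
Context (G : finGroupType) (M : topologicalType).

Record continuous_left_action := ContinuousLeftAction {
  gact :> G -> M -> M ;
  gact1 : forall x, gact 1%g x = x ;
  gactM : forall g h x, gact (g * h)%g x = gact g (gact h x) ;
  gact_continuous : forall g, continuous (gact g) }.

Implicit Types (act : continuous_left_action) (x : M).

Definition effective act : Prop :=
  forall g, (forall x, act g x = x) -> g = 1%g.

Definition orbit_of act x : set M := [set act g x | g in [set: G]].

Definition isotropy act x : set G := [set g | act g x = x].

Definition free_type act x : Prop := isotropy act x = [set 1%g].

End Action.

Notation power M n := (prod_topology (fun _ : 'I_n => M)).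

Notation unit_itv := (`[0%R, 1%R]%classic).

Section OrbitConfiguration.
Context (G : finGroupType) (M : topologicalType).
Context (act : continuous_left_action G M) (n : nat).

Definition orbit_config : set (power M n) :=
  [set y | forall i j, i != j ->
     orbit_of act (y i) `&` orbit_of act (y j) = set0].

Definition power_act (g : 'I_n -> G) (y : power M n) : power M n :=
  fun i => act (g i) (y i).

Definition reindex_point (y : power M n) (sigma : 'S_n) : power M n :=
  fun i => y (sigma i).

End OrbitConfiguration.

Arguments orbit_config {G M} act n _.

(* A path is a total function on R of which only the values on [0, 1] matter;
   continuity into a subset A of T with the subspace topology amounts to
   continuity into T together with values in A. *)
Section Paths.
Context (R : realType) (T : topologicalType).
Implicit Types (A : set T) (a b : R -> T).

Definition path_in A a : Prop :=
  {within unit_itv, continuous a} /\ forall s, unit_itv s -> A (a s).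

Definition homotopic_rel_endpoints A a b : Prop :=
  exists H : R * R -> T,
    [/\ {within unit_itv `*` unit_itv, continuous H},
        forall s t, unit_itv s -> unit_itv t -> A (H (s, t)),
        forall s, unit_itv s -> H (s, 0) = a s /\ H (s, 1) = b s,
        forall t, unit_itv t -> H (0, t) = a 0 /\ H (0, t) = b 0
      & forall t, unit_itv t -> H (1, t) = a 1 /\ H (1, t) = b 1].

End Paths.

Section OrbitBraids.
Context (R : realType) (G : finGroupType) (M : topologicalType).
Context (act : continuous_left_action G M) (n : nat).
Implicit Types (alpha beta : R -> power M n) (a : R -> M).

Definition string a : set (M * R) := [set (a s, s) | s in unit_itv].

Definition strings alpha : set (set (M * R)) :=
  [set string (alpha ^~ i) | i in [set: 'I_n]].

Definition translate_string (h : G) (c : set (M * R)) : set (M * R) :=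
  [set (act h p.1, p.2) | p in c].

Definition orbit_string a : set (set (M * R)) :=
  [set translate_string h (string a) | h in [set: G]].

Definition orbit_strings alpha : set (set (set (M * R))) :=
  [set orbit_string (alpha ^~ i) | i in [set: 'I_n]].

Definition act_path (g : 'I_n -> G) alpha : R -> power M n :=
  fun s => power_act act g (alpha s).

Definition is_orbit_braid_at (x : power M n) alpha : Prop :=
  alpha 0 = x /\
  exists (g : 'I_n -> G) (sigma : 'S_n),
    alpha 1 = power_act act g (reindex_point x sigma).

(* the unordered collection of points of C at level s0 *)
Definition slice (C : set (set (M * R))) (s0 : R) : set (M * R) :=
  [set p | p.2 = s0 /\ exists2 c, C c & c p].

(* F-hat_i (s, t) = (F_i (s, t), s) *)
Definition track (F : 'I_n -> R * R -> M) (i : 'I_n) (p : R * R) : M * R :=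
  (F i p, p.1).

(* The equalities of disjoint unions are equalities of unordered collections:
   of strings at the times t = 0 and t = 1, of points at the levels s = 0 and
   s = 1. *)
Definition G_isotopic alpha beta : Prop :=
  [/\ alpha 0 = beta 0, alpha 1 = beta 1 &
  exists F : 'I_n -> R * R -> M,
    [/\ forall i, {within unit_itv `*` unit_itv, continuous (track F i)},
        [set [set track F i (s, 0) | s in unit_itv] | i in [set: 'I_n]]
          = strings alpha /\
        [set [set track F i (s, 1) | s in unit_itv] | i in [set: 'I_n]]
          = strings beta,
        forall t, unit_itv t ->
          [set track F i (0, t) | i in [set: 'I_n]] = slice (strings alpha) 0 /\
          slice (strings alpha) 0 = slice (strings beta) 0,
        forall t, unit_itv t ->
          [set track F i (1, t) | i in [set: 'I_n]] = slice (strings alpha) 1 /\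
          slice (strings alpha) 1 = slice (strings beta) 1
      & forall s t, unit_itv s -> unit_itv t -> forall i j, i != j ->
          orbit_of act (F i (s, t)) `&` orbit_of act (F j (s, t)) = set0]].

Definition orbit_braid_equiv alpha beta : Prop :=
  exists g h : 'I_n -> G, G_isotopic (act_path g alpha) (act_path h beta).

End OrbitBraids.

(* Main.v *)
Require Import Defs.
From mathcomp Require Import all_boot all_order all_algebra all_fingroup.
From mathcomp Require Import all_classical all_reals all_analysis.

(** An orbit braid determines its path up to relabelling the strings and
    translating each of them by an element of G. An isotopy therefore is a
    homotopy between such modified paths: its end levels stay in a finite set,
    hence are constant because M is Hausdorff and the interval is connected.
    Conversely, if the modifications [alpha'] of [alpha] and [beta'] of [beta]
    have the same initial point, then, as the orbits of the points of [x] are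
    disjoint and free, they use the same relabelling and the same translations,
    so that a homotopy from [alpha'] to [beta'] is an isotopy. *)

Set Implicit Arguments.
Unset Strict Implicit.
Unset Printing Implicit Defensive.

Import Order.TTheory GRing.Theory Num.Theory.
Import numFieldNormedType.Exports.

Local Open Scope classical_set_scope.
Local Open Scope ring_scope.

(** Finite sets are closed in a Hausdorff space. Both [[set x]] and [C] minus [x] are finite, so
    [[set x]] is closed and open in the connected set [C]. *)
Lemma connected_finite_subsingleton (T : topologicalType) (C : set T)
    (x y : T) :
  hausdorff_space T -> connected C -> finite_set C -> C x -> C y -> x = y.
Proof.
move=> /hausdorff_accessible/accessible_finite_set_closed cl cC fC Cx Cy.
suff : [set x] = C by move=> xC; move: Cy; rewrite -xC => ->.
apply: cC; first by exists x.
- exists (~` (C `\ x)).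
    by apply: closed_openC; apply: cl; apply: sub_finite_set fC => z [].
  apply/seteqP; split => [z ->|z [Cz nCz]]; first by split => // -[_]; apply.
  by apply: contrapT => zx; apply: nCz.
- exists [set x]; first by apply: cl; exact: finite_set1.
  by apply/seteqP; split => [z ->//|z []].
Qed.

(** Serves to restrict a map on the square to its segments with one coordinate fixed. *)
Lemma within_continuous_reparam (T U V : topologicalType) (A : set T)
    (B : set U) (f : U -> V) (g : T -> U) :
  continuous g -> (forall z, A z -> B (g z)) ->
  {within B, continuous f} -> {within A, continuous (f \o g)}.
Proof.
move=> cg gAB /subspace_continuousP cf; apply/subspace_continuousP => z Az.
apply: cvg_trans (cf _ (gAB _ Az)) => P /= BP.
have := cg z _ BP; rewrite /= /nbhs /= /within /=.
by apply: filterS => w Pw Aw; exact/Pw/gAB.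
Qed.

Lemma within_continuous_powerP (T M : topologicalType) (n : nat) (A : set T)
    (f : T -> power M n) :
  {within A, continuous f} <-> forall i, {within A, continuous (f ^~ i)}.
Proof.
split=> [cf i|cf].
  apply: (within_continuous_comp A f (fun y : power M n => y i)) => // y _.
  exact: (@proj_continuous _ (fun _ : 'I_n => M) i y).
(* The product topology is the supremum of the topologies induced by the projections, so each of
   these can be tested separately. *)
move=> z; apply/cvg_sup => i U [V [[W oW <-] Wfz WU]].
apply: filterS WU _; apply: (cf i z).
by apply: open_nbhs_nbhs; split.
Qed.

Section Strings.
Context (R : realType) (G : finGroupType) (M : topologicalType).
Context (act : continuous_left_action G M) (n : nat).
Implicit Types (a b : R -> M) (alpha beta : R -> power M n).

(** A string is the graph of its path over the interval, because each point carries its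
    parameter. *)
Lemma string_inj a b : string a = string b -> {in unit_itv, a =1 b}.
Proof.
move=> ab s; rewrite inE => Is.
have : string b (a s, s) by rewrite -ab; exists s.
by case=> t _ [<- ->].
Qed.

Lemma translate_stringE h a :
  translate_string act h (string a) = string (act h \o a).
Proof.
apply/seteqP; split => [_ [_ [s Is <-] <-]|_ [s Is <-]]; first by exists s.
by exists (a s, s) => //; exists s.
Qed.

(** The translate by the identity puts [string a] itself into its orbit string, so it is one of the
    translates of [string b]. *)
Lemma orbit_string_inj a b : orbit_string act a = orbit_string act b ->
  exists h, {in unit_itv, a =1 act h \o b}.
Proof.
move=> ab; have : orbit_string act b (string a).
  rewrite -ab; exists 1%g => //; rewrite translate_stringE.
  by congr string; apply/funext => s /=; rewrite Defs.gact1.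
by case=> h _; rewrite translate_stringE => /esym/string_inj; exists h.
Qed.

(** Right multiplication by [h] permutes [G], so the same translates are collected. *)
Lemma orbit_string_translate h a :
  orbit_string act (act h \o a) = orbit_string act a.
Proof.
apply/seteqP; split => _ [k _ <-]; rewrite translate_stringE.
  exists (k * h)%g => //; rewrite translate_stringE.
  by congr string; apply/funext => s /=; rewrite Defs.gactM.
exists (k * h^-1)%g => //; rewrite translate_stringE.
by congr string; apply/funext => s /=; rewrite -Defs.gactM -mulgA mulVg mulg1.
Qed.

Lemma orbit_strings_act_path (g : 'I_n -> G) alpha :
  orbit_strings act (act_path act g alpha) = orbit_strings act alpha.
Proof.
by apply/eq_imagel => i _; exact: (orbit_string_translate (g i) (alpha ^~ i)).
Qed.

Lemma orbit_strings_eq alpha beta :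
  strings alpha = strings beta ->
  orbit_strings act alpha = orbit_strings act beta.
Proof.
(* An orbit string depends on its path only through the string, so [orbit_strings] factors through
   [strings]. *)
have E gamma : orbit_strings act gamma =
    (fun c => [set translate_string act h c | h in [set: G]]) @` strings gamma.
  by rewrite /strings image_comp.
by rewrite !E => ->.
Qed.

Lemma strings_perm alpha beta (sigma : 'S_n) :
  (forall i s, unit_itv s -> alpha s i = beta s (sigma i)) ->
  strings alpha = strings beta.
Proof.
move=> ab.
have abE i : string (alpha ^~ i) = string (beta ^~ (sigma i)).
  by apply: eq_imagel => s Is; rewrite ab.
apply/seteqP; split => _ [i _ <-]; first by exists (sigma i).
by exists (sigma^-1%g i) => //; rewrite abE permKV.
Qed.

Lemma slice_strings alpha s : unit_itv s ->
  slice (strings alpha) s = [set (alpha s i, s) | i in [set: 'I_n]].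
Proof.
move=> Is; apply/seteqP; split => [p [ps [_ [i _ <-] [t It tp]]]|_ [i _ <-]].
  by move: ps; rewrite -tp /= => <-; exists i.
by split=> //; exists (string (alpha ^~ i)); [exists i|exists s].
Qed.

Lemma orbit_config_index_inj (y : power M n) (g h : G) i j :
  orbit_config act n y -> act g (y i) = act h (y j) -> i = j.
Proof.
move=> cy gh; apply/eqP/negPn/negP => ij.
have : (orbit_of act (y i) `&` orbit_of act (y j)) (act g (y i)).
  by split; [exists g|exists h].
by rewrite cy.
Qed.

Lemma free_type_inj (x : M) (g h : G) :
  free_type act x -> act g x = act h x -> g = h.
Proof.
move=> fx gh; have : isotropy act x (h^-1 * g)%g.
  by rewrite /isotropy /= Defs.gactM gh -Defs.gactM mulVg Defs.gact1.
by rewrite fx => /= hg; rewrite -[LHS](mulKVg h) hg mulg1.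
Qed.

(** Each string of [alpha'] is a translate of some string of [alpha]. Two strings of [alpha'] coming
    from the same one would start in the same orbit, so the choice of indices is injective, hence a
    permutation. *)
Lemma orbit_strings_relabel alpha alpha' :
  orbit_config act n (alpha' 0) ->
  orbit_strings act alpha' = orbit_strings act alpha ->
  exists (sigma : 'S_n) (h : 'I_n -> G),
    forall i s, unit_itv s -> alpha' s i = act (h i) (alpha s (sigma i)).
Proof.
move=> ca' aa'.
have I0 : unit_itv (0 : R) by rewrite /= in_itv/= lexx ler01.
have /choice[f fP] i : exists jh : 'I_n * G,
    forall s, unit_itv s -> alpha' s i = act jh.2 (alpha s jh.1).
  have : orbit_strings act alpha (orbit_string act (alpha' ^~ i)).
    by rewrite -aa'; exists i.
  case=> j _ /esym/orbit_string_inj[h hP]; exists (j, h) => s Is.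
  by rewrite hP ?inE.
have inj_f : injective (fun i => (f i).1).
  move=> i j ij; apply: (orbit_config_index_inj (g := (f i).2^-1%g)
    (h := (f j).2^-1%g) ca').
  by rewrite !fP // -!Defs.gactM !mulVg !Defs.gact1 ij.
by exists (perm inj_f), (fun i => (f i).2) => i s Is; rewrite permE fP.
Qed.

End Strings.

Theorem proposition2p2 (R : realType) (m : nat) (hm : (2 <= m)%N)
    (M : topologicalType) (hM : topological_manifold R m M)
    (hconn : connected [set: M])
    (G : finGroupType) (act : continuous_left_action G M)
    (heff : effective act)
    (n : nat) (hn : (2 <= n)%N)
    (x : power M n) (hx : orbit_config act n x)
    (hfree : forall i, free_type act (x i))
    (alpha beta : R -> power M n)
    (halpha : path_in (orbit_config act n) alpha)
    (hbeta : path_in (orbit_config act n) beta)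
    (bralpha : is_orbit_braid_at act x alpha)
    (brbeta : is_orbit_braid_at act x beta) :
  orbit_braid_equiv act alpha beta <->
  exists alpha' beta' : R -> power M n,
    [/\ path_in (orbit_config act n) alpha',
        path_in (orbit_config act n) beta',
        orbit_strings act alpha' = orbit_strings act alpha,
        orbit_strings act beta' = orbit_strings act beta
      & homotopic_rel_endpoints (orbit_config act n) alpha' beta'].
Proof.
have I0 : unit_itv (0 : R) by rewrite /= in_itv/= lexx ler01.
have I1 : unit_itv (1 : R) by rewrite /= in_itv/= lexx ler01.
split.
- case=> g [h [_ _ [F [cF [Fa Fb] F0 F1 Fdisj]]]].
  have cH : {within unit_itv `*` unit_itv, continuous
      (fun p : R * R => (fun i => F i p) : power M n)}.
    apply/within_continuous_powerP => i.
    apply: (within_continuous_comp _ (track F i) fst) => // p _.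
    exact: cvg_fst.
  have cpath t : unit_itv t -> {within unit_itv, continuous
      (fun s => (fun i => F i (s, t)) : power M n)}.
    move=> It; apply: (within_continuous_reparam (g := pair^~ t) _ _ cH) => //.
    by move=> s; apply: (@cvg_pair _ _ _ _ (nbhs s) (nbhs t));
        [exact: cvg_id|exact: cvg_cst].
  (* With [s] fixed, [F i] maps the interval onto a connected set inside the finite set [S]. *)
  have end_const s (S : set M) i : unit_itv s -> finite_set S ->
      (forall t, unit_itv t -> S (F i (s, t))) ->
      forall t u, unit_itv t -> unit_itv u -> F i (s, t) = F i (s, u).
    move=> Is fS FS t u It Iu.
    apply: (@connected_finite_subsingleton _ [set F i (s, v) | v in unit_itv]).
    + by case: hM.
    + apply: connected_continuous_connected; first exact: segment_connected.
      move/within_continuous_powerP : cH => /(_ i).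
      apply: (within_continuous_reparam (g := pair s)) => //.
      by move=> v; apply: (@cvg_pair _ _ _ _ (nbhs s) (nbhs v));
        [exact: cvg_cst|exact: cvg_id].
    + by apply: sub_finite_set fS => _ [v Iv <-]; exact: FS.
    + by exists t.
    + by exists u.
  (* To be applied at [s = 0] and [s = 1], where the isotopy keeps every [F i (s, t)] among the
     finitely many points of the translated [alpha] at that level. *)
  have ends s : unit_itv s -> (forall t, unit_itv t ->
        [set track F i (s, t) | i in [set: 'I_n]] =
        slice (strings (act_path act g alpha)) s) ->
      forall t u, unit_itv t -> unit_itv u ->
      (fun i => F i (s, t)) = (fun i => F i (s, u)) :> power M n.
    move=> Is Fs t u It Iu; apply/funext => i.
    apply: (end_const s [set act_path act g alpha s j | j in [set: 'I_n]]) => //.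
      exact/finite_image/finite_finset.
    move=> v Iv.
    have : slice (strings (act_path act g alpha)) s (F i (s, v), s).
      by rewrite -(Fs v Iv); exists i.
    by rewrite slice_strings // => -[j _ [<-]]; exists j.
  (* The paths are the levels [t = 0] and [t = 1] of the isotopy, with the labels of [F], which may
     order the strings differently from [alpha] and [beta]. *)
  exists (fun s i => F i (s, 0)), (fun s i => F i (s, 1)); split.
  + by split; [exact: cpath|move=> s Is i j; exact: Fdisj].
  + by split; [exact: cpath|move=> s Is i j; exact: Fdisj].
  + by rewrite -(orbit_strings_act_path act g alpha);
      exact: (orbit_strings_eq act Fa).
  + by rewrite -(orbit_strings_act_path act h beta);
      exact: (orbit_strings_eq act Fb).
  + exists (fun p i => F i p); split; [exact: cH|..].
    * by move=> s t Is It i j; exact: Fdisj.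
    * by [].
    * by move=> t It; split; apply: ends => // u Iu; case: (F0 u Iu).
    * by move=> t It; split; apply: ends => // u Iu; case: (F1 u Iu).
- case=> alpha' [beta' [[_ ca'] [_ cb'] oa ob [H [cH HA H01 H0 H1]]]].
  have [sigma [h hP]] := orbit_strings_relabel (ca' _ I0) oa.
  have [tau [k kP]] := orbit_strings_relabel (cb' _ I0) ob.
  have a'b'0 : alpha' 0 = beta' 0 by have [<- <-] := H0 0 I0.
  have a'b'1 : alpha' 1 = beta' 1 by have [<- <-] := H1 0 I0.
  have a0 : alpha 0 = x by case: bralpha.
  have b0 : beta 0 = x by case: brbeta.
  (* Both sides are the common initial point of [alpha'] and [beta'], as [alpha] and [beta] start at
     [x]. *)
  have hk i : act (h i) (x (sigma i)) = act (k i) (x (tau i)).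
    by rewrite -{1}a0 -{1}b0 -hP // -kP // a'b'0.
  have st i : sigma i = tau i := orbit_config_index_inj hx (hk i).
  have {}hk i : h i = k i.
    by apply: (free_type_inj (hfree (sigma i))); rewrite hk st.
  (* The translations [h] are indexed by the strings of [alpha']; [g] indexes them by the strings of
     [alpha]. *)
  pose g j := h (sigma^-1%g j).
  have aE i s : unit_itv s -> alpha' s i = act_path act g alpha s (sigma i).
    by move=> Is; rewrite /act_path /power_act /g permK hP.
  have bE i s : unit_itv s -> beta' s i = act_path act g beta s (sigma i).
    by move=> Is; rewrite /act_path /power_act /g permK kP // hk st.
  have sa := strings_perm aE; have sb := strings_perm bE.
  (* An isotopy requires equal endpoints as labelled tuples; undoing the common relabelling [sigma]
     gives this at [s = 0] and [s = 1]. *)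
  have same s : unit_itv s -> alpha' s = beta' s ->
      act_path act g alpha s = act_path act g beta s.
    by move=> Is ab; apply/funext => j;
      rewrite -(permKV sigma j) -aE // -bE // ab.
  exists g, g; split; [exact: same|exact: same|].
  exists (fun i p => H p i); split.
  + move=> i; apply/subspace_continuousP => p Ip.
    apply: (@cvg_pair _ _ _ _ (nbhs (H p i)) (nbhs p.1)).
      move: p Ip; apply/subspace_continuousP.
      by move/within_continuous_powerP : cH => /(_ i).
    by apply: cvg_within_filter; exact: cvg_fst.
  (* The levels of [H] at [t = 0] and [t = 1] are [alpha'] and [beta'] with their own labels, whence
     the identity permutation. *)
  + split; rewrite -(sa, sb).
    * apply: (strings_perm (sigma := 1%g)) => i s Is; rewrite perm1.
      by have [-> _] := H01 s Is.
    * apply: (strings_perm (sigma := 1%g)) => i s Is; rewrite perm1.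
      by have [_ ->] := H01 s Is.
  + move=> t It; rewrite -sa -sb !slice_strings // a'b'0; split => //.
    by apply: eq_imagel => i _; rewrite /track; have [_ ->] := H0 t It.
  + move=> t It; rewrite -sa -sb !slice_strings // a'b'1; split => //.
    by apply: eq_imagel => i _; rewrite /track; have [_ ->] := H1 t It.
  + by move=> s t Is It i j; exact: HA.
Qed.
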